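(* Let $f$ and $g$ be two rules, not necessarily with the same number of players. Then $$\mathrm{Sol}_fP=\mathrm{Sol}_gP\text{ for all }P\in\mathcal{L}\iff \mathrm{ord}_fP=\mathrm{ord}_gP\text{ for all }P\in\mathcal{L}.$$
   Context: Positions are finite tuples $P=(a_1,\dots,a_k)$ of integers with $a_1\geqslant\dots\geqslant a_k\geqslant0$, where tuples differing only by trailing zeros are identified. $(0)$ is the empty position, $\mathcal{L}$ is the set of positions other than $(0)$, and $|P|=\sum a_i$ is the volume of $P$. A chomp move $P\to Q$ from $P=(a_1,\dots,a_k)$ chooses $1\leqslant x\leqslant k$ and an integer $a\geqslant0$, and sets $Q=(b_1,\dots,b_k)$ with $b_j=a_j$ for $j<x$ and $b_j=\min(a_j,a)$ for $j\geqslant x$, where $Q$ must be a different position from $P$. Write $\mathrm{Mov}P=\{Q:P\to Q\}$. An $n$-player rule is a tuple $f=(\alpha_1\cdots\alpha_n)$ of distinct reals. Ordinals $\mathrm{ord}_f$ are defined recursively on volume as follows. - $\mathrm{ord}_f(0)=0$. - For a position $Q$, set $s_f(Q)=\alpha_{\mathrm{ord}_fQ+1}$ if $\mathrm{ord}_fQ<n$ and $s_f(Q)=\alpha_1$ if $\mathrm{ord}_fQ=n$. - For $P\in\mathcal{L}$, $\mathrm{ord}_fP$ is the unique $i\in\{1,\dots,n\}$ with $\alpha_i=\max_{Q\in\mathrm{Mov}P}s_f(Q)$. If $s_f((0))$ equals this maximum, then $\mathrm{Sol}_fP=\{(0)\}$. Otherwise $\mathrm{Sol}_fP=\{Q\in\mathrm{Mov}P: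 s_f(Q)=\max_{Q'\in\mathrm{Mov}P}s_f(Q')\}$. *)

(* Defs.v *)
From HB Require Import structures.
From mathcomp Require Import all_boot all_order all_algebra.
From mathcomp Require Import boolp classical_sets reals.

Set Implicit Arguments.
Unset Strict Implicit.
Unset Printing Implicit Defensive.

Import Order.TTheory GRing.Theory Num.Theory.

Local Open Scope classical_set_scope.

(* Tuples that differ by trailing zeros are identified, so a position is       *)
(* represented by its unique representative without zero entries.              *)
Definition is_position (s : seq nat) : bool := sorted geq s && (0 \notin s).

Record position := Position { rows :> seq nat; _ : is_position rows }.

HB.instance Definition _ := [isSub for rows].
HB.instance Definition _ := [Choice of position by <:].

Definition empty : position := @Position [::] isT.

Definition volume (P : position) : nat := sumn P.

(* Row indices start at 0: [chomp P x a] truncates the rows a_(x+1), a_(x+2), ... *)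
Definition chomp_seq (s : seq nat) (x a : nat) : seq nat :=
  [seq b <- take x s ++ [seq minn b a | b <- drop x s] | 0 < b].

Lemma is_position_chomp (P : position) (x a : nat) :
  is_position (chomp_seq P x a).
Proof.
case: P => s /= /andP[srt _]; apply/andP; split; last first.
  by rewrite mem_filter.
have geq_tr : transitive geq by move=> m n p /= h1 h2; exact: leq_trans h2 h1.
apply: sorted_filter => //.
move: srt; rewrite !(sorted_pairwise geq_tr).
rewrite -{1}(cat_take_drop x s) !pairwise_cat => /and3P[h1 h2 h3].
apply/and3P; split=> //.
- apply/allrelP => u v hu /mapP[w hw ->].
  by apply: leq_trans (geq_minl _ _) _; move/allrelP: h1; apply.
- rewrite pairwise_map; apply: sub_pairwise h3 => u v /= huv.
  by rewrite leq_min geq_minr andbT (leq_trans (geq_minl _ _)).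
Qed.

Definition chomp (P : position) (x a : nat) : position :=
  Position (is_position_chomp P x a).

Definition Mov (P : position) : set position :=
  [set Q | exists x a : nat, [/\ x < size P, Q = chomp P x a & Q <> P]].

(* Enumeration of [Mov P] (see [mem_moves]): a >= a_1 leaves P unchanged.      *)
Definition moves (P : position) : seq position :=
  [seq Q <- [seq chomp P x a | x <- iota 0 (size P), a <- iota 0 (head 0 P)]
     | Q != P].

Lemma mem_moves (P Q : position) : Q \in moves P <-> Mov P Q.
Proof.
rewrite mem_filter; split.
  move=> /andP[/eqP QP /allpairsP[[x a] /= []]].
  rewrite !mem_iota /= !add0n => hx ha e.
  by exists x, a; split.
move=> [x [a [hx e QP]]]; apply/andP; split; first exact/eqP.
have [ha|ha] := ltnP a (head 0 P).
  by apply/allpairsP; exists (x, a); split=> //=; rewrite mem_iota.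
case: QP; rewrite e; apply: val_inj => /=.
case: P hx ha {e} => s /=; rewrite /chomp_seq => /andP[srt s0] hx ha.
have sle : {in s, forall b, b <= a}.
  case: s srt {s0 hx} ha => [|h t] //= srt ha b.
  rewrite inE => /predU1P[->//|hb].
  have geq_tr : transitive geq by move=> m n p /= h1 h2; exact: leq_trans h2 h1.
  move: srt; rewrite (path_sortedE geq_tr) => /andP[/allP /(_ _ hb) hbh _].
  exact: leq_trans hbh ha.
have -> : [seq minn b a | b <- drop x s] = drop x s.
  rewrite -[RHS]map_id; apply/eq_in_map => b /mem_drop /sle hb.
  exact/minn_idPl.
rewrite cat_take_drop; apply/all_filterP/allP => b hb.
by rewrite lt0n; apply: contraNneq s0 => <-.
Qed.

Record rule (R : realType) (n : nat) :=
  Rule { alpha :> n.-tuple R; alpha_uniq : uniq alpha }.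

Section Ord.
Variables (R : realType) (n : nat) (f : rule R n).

(* [nth 0 f i] is alpha_(i+1).                                                 *)
Definition score (o : nat) : R :=
  if o < n then nth 0%R f o else nth 0%R f 0.

(* The default value of the maximum is harmless: [empty] is in [Mov P] for     *)
(* every nonempty P (see [max_scoreP]).                                        *)
Definition max_score (o : position -> nat) (P : position) : R :=
  \big[Num.max/score (o empty)]_(Q <- moves P) score (o Q).

(* [v] bounds the volume of the position; [ordE] is the resulting recursion.   *)
Fixpoint ord_rec (v : nat) (P : position) : nat :=
  if v is v'.+1 then
    if P == empty then 0 else (index (max_score (ord_rec v') P) f).+1
  else 0.

Definition ord (P : position) : nat := ord_rec (volume P) P.

Definition pos_score (Q : position) : R := score (ord Q).

Definition Sol (P : position) : set position :=
  if pos_score empty == max_score ord P then [set empty]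
  else [set Q | Mov P Q /\ pos_score Q = max_score ord P].

End Ord.

Lemma volume_eq0 (P : position) : (volume P == 0) = (P == empty).
Proof.
case: P => [[|h t] pP]; first by rewrite -val_eqE.
rewrite -[RHS]val_eqE /volume /= addn_eq0; case: h pP => // pP.
by have := pP; rewrite /is_position inE /= andbF.
Qed.

Lemma Mov_empty (P : position) : P != empty -> Mov P empty.
Proof.
move=> P0; exists 0, 0; split; last by move/esym/eqP; rewrite (negPf P0).
  by rewrite lt0n size_eq0; apply: contra P0 => /eqP P0; apply/eqP/val_inj.
apply: val_inj => /=; rewrite /chomp_seq take0 drop0 /=.
by elim: (rows P) => //= h t <-; rewrite minn0.
Qed.

Lemma Mov_volume (P Q : position) : Mov P Q -> volume Q < volume P.
Proof.
move=> [x [a [hx -> QP]]].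
pose m := take x P ++ [seq minn b a | b <- drop x P].
have sumF (t : seq nat) : sumn [seq b <- t | 0 < b] = sumn t.
  by elim: t => //= -[|h] t /= ->.
have le (t : seq nat) : sumn [seq minn b a | b <- t] <= sumn t ?= iff
    ([seq minn b a | b <- t] == t).
  elim: t => [|h t IH] /=; first exact/leqif_refl.
  rewrite eqseq_cons; apply: leqif_add => //.
  by split; [exact: geq_minl|].
rewrite /volume /= /chomp_seq sumF sumn_cat.
rewrite -[in ltnRHS](cat_take_drop x (rows P)) sumn_cat ltn_add2l.
rewrite (ltn_leqif (le _)); apply/eqP => e; apply: QP; apply: val_inj => /=.
rewrite /chomp_seq e cat_take_drop; apply/all_filterP/allP => b hb.
rewrite lt0n; case: P hx m e hb => r /= /andP[_ r0] _ _ _ hb.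
by apply: contraNneq r0 => <-.
Qed.

Section OrdTheory.
Variables (R : realType) (n : nat) (f : rule R n).

Lemma ord_empty : ord f empty = 0.
Proof. by []. Qed.

Lemma eq_max_score (o o' : position -> nat) (P : position) :
  o empty = o' empty -> (forall Q, Mov P Q -> o Q = o' Q) ->
  max_score f o P = max_score f o' P.
Proof.
move=> e0 e; rewrite /max_score e0; apply: eq_big_seq => Q /mem_moves hQ.
by rewrite e.
Qed.

Lemma ord_recE (v : nat) (P : position) :
  volume P <= v -> ord_rec f v P = ord f P.
Proof.
have ord_rec0 w : ord_rec f w empty = 0 by case: w.
rewrite /ord; move: {2}(volume P) (leqnn (volume P)) => w.
elim: w v P => [|w IH] v P hw hv.
  move: hw; rewrite leqn0 volume_eq0 => /eqP ->; exact: ord_rec0.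
case: (eqVneq P empty) => [->|P0]; first by rewrite !ord_rec0.
case: v hv => [|v] hv.
  by move: hv; rewrite leqn0 volume_eq0 (negPf P0).
case e: (volume P) => [|u].
  by move/eqP: e; rewrite volume_eq0 (negPf P0).
rewrite /= (negPf P0); congr (index _ _).+1.
apply: eq_max_score => [|Q /Mov_volume hQ]; first by rewrite !ord_rec0.
have hQw : volume Q <= w by rewrite -ltnS (leq_trans hQ).
rewrite IH // ?[in RHS]IH //.
  by rewrite -ltnS -e.
by rewrite -ltnS (leq_trans hQ).
Qed.

Lemma ordE (P : position) : P != empty ->
  ord f P = (index (max_score f (ord f) P) f).+1.
Proof.
move=> P0; rewrite {1}/ord; case e: (volume P) => [|u].
  by move/eqP: e; rewrite volume_eq0 (negPf P0).
rewrite /= (negPf P0); congr (index _ _).+1.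
apply: eq_max_score => [|Q /Mov_volume hQ]; first by case: (u).
by rewrite ord_recE // -ltnS -e.
Qed.

Lemma max_scoreP (P : position) : P != empty ->
  (exists2 Q, Mov P Q & pos_score f Q = max_score f (ord f) P) /\
  (forall Q, Mov P Q -> (pos_score f Q <= max_score f (ord f) P)%R).
Proof.
move=> P0; rewrite /max_score; split; last first.
  by move=> Q /mem_moves hQ; exact: le_bigmax_seq.
rewrite big_seq; elim/big_ind: _.
- by exists empty => //; exact: Mov_empty.
- move=> x y [Q hQ <-] [Q' hQ' <-]; rewrite /Num.max.
  by case: ifP => _; [exists Q'|exists Q].
- by move=> Q /mem_moves hQ; exists Q.
Qed.

Lemma max_score_mem (P : position) : 0 < n -> P != empty ->
  max_score f (ord f) P \in alpha f.
Proof.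
move=> n0 P0; have [[Q _ <-] _] := max_scoreP P0.
by rewrite /pos_score /score; case: ifP => h; rewrite mem_nth // size_tuple.
Qed.

Lemma ord_spec (P : position) : 0 < n -> P != empty -> forall i,
  (ord f P = i) <->
  (1 <= i <= n /\ nth 0%R f i.-1 = max_score f (ord f) P).
Proof.
move=> n0 P0 i; rewrite ordE //; have hm := max_score_mem n0 P0; split.
  move=> <-; split; last exact: nth_index.
  by rewrite /= -[X in _ < X](size_tuple (alpha f)) index_mem.
case: i => [|i] [//= hi <-].
by rewrite index_uniq ?size_tuple // alpha_uniq.
Qed.

End OrdTheory.

(* Main.v *)
Require Import Defs.
From HB Require Import structures.
From mathcomp Require Import all_boot all_order all_algebra.
From mathcomp Require Import boolp classical_sets reals.

(** [Sol f P] is [{(0)}] when [P] has ordinal 1, and otherwise consists of the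
    moves whose ordinal is one less than that of [P]; hence the ordinals determine
    the solutions.  Conversely, the ordinal of [P] is 1 when [Sol f P = {(0)}], and
    otherwise it is one more than the ordinal of any element of [Sol f P], so it is
    recovered from the solutions by induction on the volume. *)

Lemma pos_score_mem (R : realType) (n : nat) (f : rule R n) (Q : position) :
  0 < n -> pos_score f Q \in alpha f.
Proof.
by move=> n0; rewrite /pos_score /score; case: ifP => h;
  rewrite mem_nth // size_tuple.
Qed.

(** The entries of [f] are distinct, so scores agree exactly when their indices do; a [Q] of ordinal
    [n] wraps around to index 0. *)
Lemma pos_score_eq_max (R : realType) (n : nat) (f : rule R n)
    (P Q : position) : 0 < n -> P != empty ->
  (pos_score f Q == max_score f (ord f) P) =
  (ord f P == if ord f Q < n then (ord f Q).+1 else 1).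
Proof.
move=> n0 P0; have fu := alpha_uniq f.
have idxQ : (index (pos_score f Q) f).+1 =
    if ord f Q < n then (ord f Q).+1 else 1.
  by rewrite /pos_score /score; case: ifP => h; rewrite index_uniq // size_tuple.
rewrite -idxQ ordE // eqSS; apply/eqP/eqP => [->//|e].
by rewrite -(nth_index 0%R (pos_score_mem _ _ f Q n0)) -e nth_index // max_score_mem.
Qed.

Lemma SolE (R : realType) (n : nat) (f : rule R n) (P : position) :
  0 < n -> P != empty ->
  Sol f P = if ord f P == 1 then [set empty]%classic
            else [set Q | Mov P Q /\ ord f P = (ord f Q).+1]%classic.
Proof.
move=> n0 P0; rewrite /Sol pos_score_eq_max // ord_empty n0.
case: ifP => // /negbT P1; apply/seteqP.
split=> Q [PQ /eqP e]; split=> //; move: e; last first.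
  (* [ord f P <= n] forces [ord f Q < n], so the score of [Q] does not wrap around. *)
  move=> /eqP e; apply/eqP; rewrite pos_score_eq_max // e.
  have [] := (ord_spec f n0 P0 (ord f P)).1 erefl.
  by rewrite e => /andP[_ ->].
(* Wrap-around would give [ord f P = 1], contrary to [P1]. *)
by rewrite pos_score_eq_max //; case: ifP => _ /eqP // e; rewrite e in P1.
Qed.

Lemma Sol_eq_empty (R : realType) (n : nat) (f : rule R n) (P : position) :
  0 < n -> P != empty -> (Sol f P = [set empty]%classic <-> ord f P = 1).
Proof.
move=> n0 P0; rewrite SolE //; split=> [|->//].
(* Otherwise [empty], of ordinal 0, would be a solution by the second branch, making [ord f P] equal
   to 1. *)
case: eqP => // P1 /seteqP[_ /(_ _ erefl)].
by rewrite /= ord_empty => -[_].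
Qed.

Lemma Sol_neq0 (R : realType) (n : nat) (f : rule R n) (P : position) :
  P != empty -> exists Q, Sol f P Q.
Proof.
move=> P0; rewrite /Sol; case: ifP => _; first by exists empty.
by have [[Q PQ eQ] _] := max_scoreP f P0; exists Q.
Qed.

Theorem theorem3p1 (R : realType) (m n : nat) (hm : 0 < m) (hn : 0 < n)
    (f : rule R m) (g : rule R n) :
  (forall P : position, P <> empty -> Sol f P = Sol g P) <->
  (forall P : position, P <> empty -> ord f P = ord g P).
Proof.
split=> [eqSol P _|eqOrd P /eqP P0].
  have [v] := ubnP (volume P); elim: v P => // v IH P; rewrite ltnS => leP.
  have [->|P0] := eqVneq P empty; first by rewrite !ord_empty.
  have eqP := eqSol P (elimN eqP P0).
  have [f1|f1] := eqVneq (ord f P) 1.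
    by rewrite f1; apply/esym/Sol_eq_empty; rewrite -?eqP //; apply/Sol_eq_empty.
  have g1 : ord g P != 1.
    by apply: contra_neq f1 => /Sol_eq_empty g1; apply/Sol_eq_empty; rewrite ?eqP ?g1.
  (* A common solution [Q] has smaller volume, so the induction hypothesis applies to it. *)
  have [Q fQ] := Sol_neq0 _ _ f P P0.
  have gQ := fQ; rewrite eqP in gQ; move: fQ gQ.
  rewrite !SolE // (negPf f1) (negPf g1) => -[PQ ->] [_ ->].
  by rewrite IH // (leq_trans (Mov_volume PQ)).
(* Moves may lead to [empty], which [eqOrd] does not cover. *)
have eqOrd' Q : ord f Q = ord g Q.
  by have [->|/eqP/eqOrd//] := eqVneq Q empty; rewrite !ord_empty.
by rewrite !SolE // eqOrd'; case: ifP => // _; apply/seteqP; split=> Q /=;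
  rewrite eqOrd'.
Qed.
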